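(* Consider Neumann boundary conditions on $\partial\Omega$. Let $\gamma=1$ for the iterative IMEX-I Euler method and $\gamma=\frac32$ for the iterative IMEX-I 2SBDF method. Let $h=\min\{\Delta x,\Delta y\}$ and assume that the steps satisfy $$\frac{\Delta tD_\phi}{\gamma+w\Delta t}\left(\frac1{\Delta x^2}+\frac1{\Delta y^2}\right)<1,\qquad\frac{\Delta tD_c}{\gamma}\left(\frac1{\Delta x^2}+\frac1{\Delta y^2}\right)<1.$$ The iterations defining the iterative IMEX-I Euler method, and the iterations defining the iterative IMEX-I 2SBDF method, converge provided that $$\left(h^2>\frac{10D_\phi}{w}\quad\text{or}\quad\Delta t<\frac{\gamma h^2}{10D_\phi-wh^2}\right)\quad\text{and}\quad\Delta t<\frac{\gamma h^2}{10D_c}.$$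
   Context: Let $\Omega=[0,L_x]\times[0,L_y]$, let $\Theta$ be a set contained in the interior of $\Omega$ (the union of the holes), and $\widehat\Omega=\Omega\setminus\Theta$. The grid is uniform with $m_x\times m_y$ nodes ($m_x,m_y\ge2$), including the boundary nodes: $(x_i,y_j)=((i-1)\Delta x,(j-1)\Delta y)$, $1\le i\le m_x$, $1\le j\le m_y$, $\Delta x=L_x/(m_x-1)$, $\Delta y=L_y/(m_y-1)$, ordered lexicographically (index $i+(j-1)m_x$); $\Theta$ contains at least one grid node. The discrete Neumann Laplacian is $\mathcal M=I_{m_y}\otimes\mathcal M_x+\mathcal M_y\otimes I_{m_x}$, where for $r\in\{x,y\}$ the $m_r\times m_r$ matrix $\mathcal M_r$ is $\frac1{\Delta r^2}$ times the tridiagonal matrix with $-2$ on the diagonal and $1$ on the sub- and superdiagonal, except that the entries in positions $(1,2)$ and $(m_r,m_r-1)$ are $2$. The matrices $\mathcal N_1,\mathcal N_2$ have entries: $(\mathcal N_1)_{p,q}=\mathcal M_{p,q}$ if node $p$ is in $\Theta$ and node $q$ is in $\widehat\Omega$, and $0$ otherwise; $(\mathcal N_2)_{p,q}=\mathcal M_{p,q}$ if node $q$ is in $\Theta$, and $0$ otherwise. The constants $D_\phi,D_c,w,\Delta t$ are positive. For the IMEX-I methods put $\mathcal N=\mathcal N_1+\mathcal N_2$. At each time step the iterative Euler method consists of the two iterations in $k=0,1,2,\dots$ $$((1+w\Delta t)I-\Delta tD_\phi\mathcal M)\boldsymbol\phi^{n+1,k+1}=-\Delta tD_\phi\mathcal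 N\boldsymbol\phi^{n+1,k}+\mathbf g_\phi,\qquad (I-\Delta tD_c\mathcal M)\mathbf c^{n+1,k+1}=-\Delta tD_c\mathcal N\mathbf c^{n+1,k}+\mathbf g_c,$$ and the iterative 2SBDF method of the two iterations $$((3+2w\Delta t)I-2\Delta tD_\phi\mathcal M)\boldsymbol\phi^{n+2,k+1}=-2\Delta tD_\phi\mathcal N\boldsymbol\phi^{n+2,k}+\mathbf g_\phi,\qquad (3I-2\Delta tD_c\mathcal M)\mathbf c^{n+2,k+1}=-2\Delta tD_c\mathcal N\mathbf c^{n+2,k}+\mathbf g_c,$$ where $\mathbf g_\phi,\mathbf g_c$ are known vectors built from already computed quantities and independent of $k$. Convergence means convergence of the sequences as $k\to\infty$ for every starting iterate. *)

(* Defs.v *)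
From mathcomp Require Import all_boot all_order all_algebra.
From mathcomp Require Import mxtens.
From mathcomp Require Import all_classical all_reals all_analysis.

Set Implicit Arguments.
Unset Strict Implicit.
Unset Printing Implicit Defensive.

Import Order.TTheory GRing.Theory Num.Theory.
Import numFieldNormedType.Exports.

Local Open Scope classical_set_scope.
Local Open Scope ring_scope.

Definition spacing (R : realType) (m : nat) (L : R) : R := L / (m%:R - 1).

Definition domain (R : realType) (Lx Ly : R) : set (R * R) :=
  [set z | (0 <= z.1 <= Lx) && (0 <= z.2 <= Ly)].

(* Nodes are numbered from 0: the node of index [p = j * mx + i], i.e.
   [mxtens_index (j, i)] with [j : 'I_my] and [i : 'I_mx], lies at
   [(i * dx, j * dy)]. *)
Definition node (R : realType) (mx my : nat) (Lx Ly : R) (p : 'I_(my * mx))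
  : R * R :=
  (((mxtens_unindex p).2 : nat)%:R * spacing mx Lx,
   ((mxtens_unindex p).1 : nat)%:R * spacing my Ly).

Definition neumann_laplacian1 (R : realType) (m : nat) (L : R) : 'M[R]_m :=
  (spacing m L ^+ 2)^-1 *:
  \matrix_(i, j)
    if i == j then - 2
    else if i.+1 == j :> nat then (if i == 0%N :> nat then 2 else 1)
    else if j.+1 == i :> nat then (if i.+1 == m :> nat then 2 else 1)
    else 0.

(* [*t] is the Kronecker product; it uses the same indexing as [node]. *)
Definition neumann_laplacian (R : realType) (mx my : nat) (Lx Ly : R)
  : 'M[R]_(my * mx) :=
  1%:M *t neumann_laplacian1 mx Lx + neumann_laplacian1 my Ly *t 1%:M.

Definition N1 (R : realType) (mx my : nat) (Lx Ly : R) (Theta : set (R * R))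
  : 'M[R]_(my * mx) :=
  \matrix_(p, q)
    if (node Lx Ly p \in Theta) &&
       (node Lx Ly q \in domain Lx Ly `\` Theta)
    then neumann_laplacian mx my Lx Ly p q else 0.

Definition N2 (R : realType) (mx my : nat) (Lx Ly : R) (Theta : set (R * R))
  : 'M[R]_(my * mx) :=
  \matrix_(p, q)
    if node Lx Ly q \in Theta
    then neumann_laplacian mx my Lx Ly p q else 0.

(* Convergence of [A *m x_(k+1) = B *m x_k + g].  Since the scheme is implicit,
   existence of the iterates is required along with convergence of every
   sequence of iterates (together these force [A] to be invertible). *)
Definition iteration_converges (R : realType) (n : nat) (A B : 'M[R]_n)
    (g : 'cV[R]_n) : Prop :=
  forall x0 : 'cV[R]_n,
    (exists x : nat -> 'cV[R]_n,
       x 0%N = x0 /\ forall k, A *m x k.+1 = B *m x k + g) /\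
    (forall x : nat -> 'cV[R]_n,
       x 0%N = x0 -> (forall k, A *m x k.+1 = B *m x k + g) -> cvgn x).

Inductive imex_method := Euler | SBDF2.

Definition gamma (R : realType) (meth : imex_method) : R :=
  match meth with Euler => 1 | SBDF2 => 3 / 2 end.

Definition phi_iteration_converges (R : realType) (meth : imex_method)
    (n : nat) (dt Dphi w : R) (M N : 'M[R]_n) (g : 'cV[R]_n) : Prop :=
  match meth with
  | Euler => iteration_converges
      ((1 + w * dt)%:M - (dt * Dphi) *: M) (- (dt * Dphi) *: N) g
  | SBDF2 => iteration_converges
      ((3 + 2 * w * dt)%:M - (2 * dt * Dphi) *: M) (- (2 * dt * Dphi) *: N) g
  end.

Definition c_iteration_converges (R : realType) (meth : imex_method)
    (n : nat) (dt Dc : R) (M N : 'M[R]_n) (g : 'cV[R]_n) : Prop :=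
  match meth with
  | Euler => iteration_converges
      (1%:M - (dt * Dc) *: M) (- (dt * Dc) *: N) g
  | SBDF2 => iteration_converges
      (3%:M - (2 * dt * Dc) *: M) (- (2 * dt * Dc) *: N) g
  end.

(* Main.v *)
Require Import Defs.
From mathcomp Require Import all_boot all_order all_algebra.
From mathcomp Require Import mxtens.
From mathcomp Require Import all_classical all_reals all_analysis.
From mathcomp Require Import zify lra ring.

Import Order.TTheory GRing.Theory Num.Theory.
Import numFieldNormedType.Exports.

Local Open Scope classical_set_scope.
Local Open Scope ring_scope.

(** Each iteration reads [A *m x_(k+1) = B *m x_k + g] with
    [A = c%:M - b *: M] and [B = - b *: N], where [M] is the discrete Neumann
    Laplacian, [b] is [dt * D] (Euler) or [2 * dt * D] (2SBDF), and [c] is the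
    coefficient of the identity.  It is a contraction in the maximum norm.

    The matrix [M] has nonnegative off-diagonal entries and zero row sums, also
    in the boundary rows, where the doubled entries make up for the missing
    neighbour ([neumann_laplacian_offdiag], [neumann_laplacian_row_sum]).  With
    [s = 2 * (1 / dx ^+ 2 + 1 / dy ^+ 2)], the opposite of its diagonal entries,
    this has two consequences.

    - In every row of [A] the diagonal entry [c + b * s] exceeds the sum of the
      absolute values of the others, [b * s], by [c].  This is a discrete
      maximum principle: [c * `|v| <= `|A *m v|] ([dominant_norm_ge]).
    - The entries of [N] are either entries of [M] or zero, because [N1] and
      [N2] have disjoint supports; so [`|B *m v| <= 2 * b * s * `|v|]
      ([N1D_N2_le], [mulmx_norm_le]).

    Hence the errors shrink at least by the factor [2 * b * s / c] at each step,
    and [2 * b * s <= 8 * b / h ^+ 2] because [h] is the smaller spacing.  The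
    bounds on [dt] say exactly that [10 * b < c * h ^+ 2], so this factor is
    less than [8 / 10]. *)

(** * Contraction of implicit iterations in the maximum norm *)

Lemma ler_mx_entry (R : realType) (m n : nat) (v : 'M[R]_(m, n)) i j :
  `|v i j| <= `|v|.
Proof.
rewrite [leRHS]/Num.Def.normr /= mx_normrE.
by apply: (le_bigmax _ (fun ij => `|v ij.1 ij.2|) (i, j)).
Qed.

Lemma mulmx_norm_le (R : realType) (m n : nat) (B : 'M[R]_(m, n))
    (v : 'cV[R]_n) (q : R) :
  0 <= q -> (forall i, \sum_j `|B i j| <= q) -> `|B *m v| <= q * `|v|.
Proof.
move=> q0 hB; rewrite [leLHS]/Num.Def.normr /= mx_normrE.
apply: bigmax_le => [|[i k] _ /=]; first by rewrite mulr_ge0.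
rewrite mxE; apply: (le_trans (ler_norm_sum _ _ _)).
apply: (@le_trans _ _ (\sum_j `|B i j| * `|v|)).
  by apply: ler_sum => j _; rewrite normrM ler_wpM2l // ler_mx_entry.
by rewrite -mulr_suml ler_wpM2r.
Qed.

(** Evaluate [A *m v] in the row where [v] attains its norm: there the diagonal
    term cannot be compensated by the others, whose entries of [v] are no
    larger. *)
Lemma dominant_norm_ge (R : realType) (n : nat) (A : 'M[R]_n)
    (v : 'cV[R]_n) (d : R) :
  (forall i, d + \sum_(j | j != i) `|A i j| <= `|A i i|) ->
  d * `|v| <= `|A *m v|.
Proof.
move=> hA; have [->|v0] := eqVneq v 0; first by rewrite mulmx0 !normr0 mulr0.
have [[i k] /= vi] : exists ij, `|v| = `|v ij.1 ij.2|.
  by apply: mx_norm_neq0; apply: contra_neq v0 => /mx_norm_eq0.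
apply: le_trans (ler_mx_entry _ _ _ (A *m v) i k).
rewrite mxE (bigD1 i) //=; apply: le_trans (lerB_normD _ _).
rewrite lerBrDr normrM -vi.
apply: (@le_trans _ _ ((d + \sum_(j | j != i) `|A i j|) * `|v|)); last first.
  by rewrite ler_wpM2r.
rewrite mulrDl lerD2l mulr_suml; apply: (le_trans (ler_norm_sum _ _ _)).
by apply: ler_sum => j _; rewrite normrM ler_wpM2l // ler_mx_entry.
Qed.

(** A lower bound on [A *m v] makes [A] injective, which is enough for a square
    matrix. *)
Lemma unitmx_norm_ge (R : realType) (n : nat) (A : 'M[R]_n) (d : R) :
  0 < d -> (forall v : 'cV[R]_n, d * `|v| <= `|A *m v|) -> A \in unitmx.
Proof.
move=> d0 hA; rewrite -unitmx_tr -row_free_unit; apply: inj_row_free => v vA.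
have Av : A *m v^T = 0 by rewrite -[A]trmxK -trmx_mul vA trmx0.
have := hA v^T; rewrite Av normr0 pmulr_rle0 // normr_le0 => /eqP v0.
by rewrite -[v]trmxK v0 trmx0.
Qed.

(** The bound [d] from below on [A] and [q] from above on [B] make [A] and
    [A - B] invertible.  So the iterates exist, there is a fixed point [s], and
    the error satisfies [A *m (x k.+1 - s) = B *m (x k - s)]: it decays like
    the powers of [q / d]. *)
Lemma dominant_iteration_converges (R : realType) (n : nat)
    (A B : 'M[R]_n) (d q : R) :
  0 <= q -> q < d ->
  (forall i, d + \sum_(j | j != i) `|A i j| <= `|A i i|) ->
  (forall i, \sum_j `|B i j| <= q) ->
  forall g : 'cV[R]_n, iteration_converges A B g.
Proof.
move=> q0 qd hA hB g x0.
have d0 : 0 < d := le_lt_trans q0 qd.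
have geA (v : 'cV[R]_n) := dominant_norm_ge _ _ A v d hA.
have leB (v : 'cV[R]_n) := mulmx_norm_le _ _ _ B v q q0 hB.
have uA : A \in unitmx by apply: unitmx_norm_ge d0 geA.
have uAB : A - B \in unitmx.
  apply: (@unitmx_norm_ge _ _ _ (d - q)) => [|v]; first by rewrite subr_gt0.
  rewrite mulmxBl mulrBl; apply: le_trans (lerB_normD _ _).
  by rewrite normrN lerB.
split=> [|x _ xS].
  exists (fun k => iter k (fun y => invmx A *m (B *m y + g)) x0); split=> // k.
  by rewrite /= mulKVmx.
pose s : 'cV[R]_n := invmx (A - B) *m g.
have As : A *m s = B *m s + g.
  by apply/eqP; rewrite addrC -subr_eq -mulmxBl mulKVmx.
have err k : `|x k - s| <= geometric `|x 0%N - s| (q / d) k.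
  elim: k => [|k IH]; first by rewrite /= expr0 mulr1.
  have step : d * `|x k.+1 - s| <= q * `|x k - s|.
    apply: le_trans (geA _) _; apply: le_trans (leB _).
    by rewrite !mulmxBr xS As opprD addrACA subrr addr0.
  rewrite -(ler_pM2l d0); apply: (le_trans step).
  apply: (le_trans (ler_wpM2l q0 IH)).
  rewrite /= exprS le_eqVlt; apply/orP; left; apply/eqP.
  by field; rewrite gt_eqF.
suff xs : x @ \oo --> s by apply: cvgP xs.
apply/cvgrPdist_le => e e0.
have qd1 : `|q / d| < 1.
  by rewrite ger0_norm ?divr_ge0 ?(ltW d0) // ltr_pdivrMr // mul1r.
have small := cvgr0_norm_le _ (cvg_geometric `|x 0%N - s| qd1) _ e0.
near=> k; rewrite distrC; apply: le_trans (err k) _.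
by apply: le_trans (ler_norm _) _; near: k; exact: small.
Unshelve. all: by end_near.
Qed.

(** * Signs and row sums of the discrete Neumann Laplacian *)

Lemma tensmx_row_sum (R : comPzRingType) (m n : nat) (A : 'M[R]_m)
    (B : 'M[R]_n) (p : 'I_(m * n)) :
  \sum_q (A *t B) p q =
  (\sum_j A (mxtens_unindex p).1 j) * (\sum_k B (mxtens_unindex p).2 k).
Proof.
rewrite big_distrlr /= pair_bigA /= (reindex (@mxtens_index m n)) /=.
  by apply: eq_bigr => -[j k] _; rewrite mxE mxtens_indexK.
by exists (@mxtens_unindex m n) => q _;
  rewrite ?mxtens_indexK ?mxtens_unindexK.
Qed.

Lemma sum_ord_eq (V : nmodType) (m k : nat) (c : V) :
  \sum_(j < m) (if k == j :> nat then c else 0) = if (k < m)%N then c else 0.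
Proof.
case: ltnP => [km|mk].
  by rewrite -big_mkcond (big_pred1 (Ordinal km)).
by apply: big1 => j _; rewrite gtn_eqF // (leq_trans (ltn_ord j)).
Qed.

Lemma neumann_laplacian1_diag (R : realType) (m : nat) (L : R) (i : 'I_m) :
  neumann_laplacian1 m L i i = - (2 / spacing m L ^+ 2).
Proof. by rewrite !mxE eqxx mulrN mulrC. Qed.

Lemma neumann_laplacian1_offdiag (R : realType) (m : nat) (L : R)
    (i j : 'I_m) :
  i != j -> 0 <= neumann_laplacian1 m L i j.
Proof.
move=> ij; rewrite !mxE (negPf ij) mulr_ge0 ?invr_ge0 ?sqr_ge0 //.
by do !case: ifP.
Qed.

(** An interior row sums to [1 - 2 + 1]; in the first and in the last row the
    only neighbour counts twice, so that it sums to [2 - 2]. *)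
Lemma neumann_laplacian1_row_sum (R : realType) (m : nat) (L : R)
    (i : 'I_m) :
  (2 <= m)%N -> \sum_j neumann_laplacian1 m L i j = 0.
Proof.
move=> m2.
pose r : R := if i == 0%N :> nat then 2 else 1.
pose l : R := if i.+1 == m :> nat then 2 else 1.
(* The three conditions of the definition exclude each other, so the entry is a
   sum of three terms.  The neighbour on the left is [i.-1], which for [i = 0]
   is [i] itself; the coefficient is then set to zero. *)
rewrite (eq_bigr (fun j : 'I_m => (spacing m L ^+ 2)^-1 *
   ((if i == j :> nat then - 2 else 0) +
    ((if i.+1 == j :> nat then r else 0) +
     (if i.-1 == j :> nat
      then if i == 0%N :> nat then 0 else l else 0))))); last first.
  move=> j _; rewrite !mxE -val_eqE /= /r /l; congr (_ * _).
  case: (ltngtP i j) => [ij|ij|->].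
  - have -> : (j.+1 == i) = false by apply/eqP; lia.
    have -> : (i.-1 == j) = false by apply/eqP; lia.
    by case: ifP; rewrite ?addr0 ?add0r.
  - have -> : (i.+1 == j) = false by apply/eqP; lia.
    have -> : (j.+1 == i) = (i.-1 == j) by apply/eqP/eqP; lia.
    have -> : (i == 0%N :> nat) = false by apply/eqP; lia.
    by rewrite !add0r.
  - have -> : (j.+1 == j) = false by apply/eqP; lia.
    case: ifP => [/eqP jj|_]; last by rewrite !addr0.
    have -> : (j == 0%N :> nat) by apply/eqP; lia.
    by rewrite !addr0.
rewrite -mulr_sumr !big_split /= !sum_ord_eq ltn_ord.
rewrite (leq_ltn_trans (leq_pred i)) //.
apply/eqP; rewrite mulf_eq0; apply/orP; right; apply/eqP; rewrite /r /l.
have := ltn_ord i.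
have [->|i0] := eqVneq (i : nat) 0%N => im; first by rewrite m2; lra.
have [->|im1] := eqVneq i.+1 m; first by rewrite ltnn; lra.
have -> : (i.+1 < m)%N by rewrite ltn_neqAle im1 im.
lra.
Qed.

Lemma neumann_laplacianE (R : realType) (mx my : nat) (Lx Ly : R)
    (p q : 'I_(my * mx)) :
  neumann_laplacian mx my Lx Ly p q =
  (if (mxtens_unindex p).1 == (mxtens_unindex q).1
   then neumann_laplacian1 mx Lx (mxtens_unindex p).2 (mxtens_unindex q).2
   else 0) +
  (if (mxtens_unindex p).2 == (mxtens_unindex q).2
   then neumann_laplacian1 my Ly (mxtens_unindex p).1 (mxtens_unindex q).1
   else 0).
Proof.
rewrite mxE [in LHS]mxE [in X in _ + X]mxE.
rewrite [1%:M _ _]mxE [1%:M _ _]mxE.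
by congr (_ + _); case: eqP => _; rewrite ?(mul1r, mulr1, mul0r, mulr0).
Qed.

Lemma neumann_laplacian_diag (R : realType) (mx my : nat) (Lx Ly : R)
    (p : 'I_(my * mx)) :
  neumann_laplacian mx my Lx Ly p p =
  - (2 * (1 / spacing mx Lx ^+ 2 + 1 / spacing my Ly ^+ 2)).
Proof.
rewrite neumann_laplacianE !eqxx !neumann_laplacian1_diag; ring.
Qed.

Lemma neumann_laplacian_offdiag (R : realType) (mx my : nat) (Lx Ly : R)
    (p q : 'I_(my * mx)) :
  p != q -> 0 <= neumann_laplacian mx my Lx Ly p q.
Proof.
rewrite -(can_eq (@mxtens_unindexK my mx)) xpair_eqE negb_and.
rewrite neumann_laplacianE.
case: eqVneq => [_|n1]; case: eqVneq => [_|n2] // _; rewrite ?addr0 ?add0r //;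
  exact: neumann_laplacian1_offdiag.
Qed.

Lemma neumann_laplacian_row_sum (R : realType) (mx my : nat) (Lx Ly : R)
    (p : 'I_(my * mx)) :
  (2 <= mx)%N -> (2 <= my)%N -> \sum_q neumann_laplacian mx my Lx Ly p q = 0.
Proof.
move=> hx hy; under eq_bigr do rewrite mxE.
rewrite big_split /= !tensmx_row_sum !neumann_laplacian1_row_sum //.
by rewrite mulr0 mul0r addr0.
Qed.

(** * Convergence of the splitting *)

(** A column of [N2] is nonzero only for a node in [Theta], and a column of [N1]
    only for a node outside, so no entry of [M] is counted twice. *)
Lemma N1D_N2_le (R : realType) (mx my : nat) (Lx Ly : R)
    (Theta : set (R * R)) (p q : 'I_(my * mx)) :
  `|(N1 mx my Lx Ly Theta + N2 mx my Lx Ly Theta) p q| <=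
  `|neumann_laplacian mx my Lx Ly p q|.
Proof.
rewrite !mxE in_setD; case: (node Lx Ly q \in Theta) => /=.
  by rewrite !andbF add0r.
by rewrite addr0; case: ifP => // _; rewrite normr0.
Qed.

(** Zero row sums and nonnegative off-diagonal entries make the off-diagonal
    part of each row of [M] have absolute sum [s].  The whole row then has
    absolute sum [2 * s], whence the factor [2]; the diagonal of
    [c%:M - b *: M] dominates its row by [c]. *)
Lemma implicit_splitting_converges (R : realType) (n : nat)
    (M N : 'M[R]_n) (b c s : R) (g : 'cV[R]_n) :
  0 <= b -> 0 <= s -> 2 * (b * s) < c ->
  (forall i, M i i = - s) -> (forall i j, i != j -> 0 <= M i j) ->
  (forall i, \sum_j M i j = 0) ->
  (forall i j, `|N i j| <= `|M i j|) ->
  iteration_converges (c%:M - b *: M) (- b *: N) g.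
Proof.
move=> b0 s0 bsc Md Mo Ms NM.
have offs i : \sum_(j | j != i) `|M i j| = s.
  have := Ms i; rewrite (bigD1 i) //= Md => /eqP.
  rewrite addrC subr_eq0 => /eqP <-; apply: eq_bigr => j ji.
  by rewrite ger0_norm // Mo // eq_sym.
apply: (dominant_iteration_converges _ _ _ _ c (2 * (b * s))) => //.
- by rewrite !mulr_ge0.
- move=> i; rewrite !mxE eqxx mulr1n Md mulrN opprK.
  rewrite ger0_norm; last first.
    by rewrite addr_ge0 ?mulr_ge0 // ltW // (le_lt_trans _ bsc) ?mulr_ge0.
  rewrite lerD2l -(offs i) mulr_sumr; apply: ler_sum => j ji.
  by rewrite !mxE eq_sym (negPf ji) mulr0n add0r normrN normrM ger0_norm.
- move=> i; apply: (@le_trans _ _ (\sum_j b * `|M i j|)).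
    apply: ler_sum => j _.
    by rewrite !mxE normrM normrN (ger0_norm b0) ler_wpM2l.
  rewrite -mulr_sumr (bigD1 i) //= offs Md normrN ger0_norm //; lra.
Qed.

(** Here [2 * (b * s) < c] with [s = 2 * (1 / dx ^+ 2 + 1 / dy ^+ 2)], and both
    [1 / dx ^+ 2] and [1 / dy ^+ 2] are at most [1 / h ^+ 2]: hence the
    constant [8]. *)
Lemma neumann_iteration_converges (R : realType) (mx my : nat) (Lx Ly : R)
    (Theta : set (R * R)) (b c : R) (g : 'cV[R]_(my * mx)) :
  (2 <= mx)%N -> (2 <= my)%N -> 0 < Lx -> 0 < Ly -> 0 <= b ->
  8 * b < c * Num.min (spacing mx Lx) (spacing my Ly) ^+ 2 ->
  iteration_converges (c%:M - b *: neumann_laplacian mx my Lx Ly)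
    (- b *: (N1 mx my Lx Ly Theta + N2 mx my Lx Ly Theta)) g.
Proof.
move=> hx hy Lx0 Ly0 b0 hb.
have sp m (L : R) : (2 <= m)%N -> 0 < L -> 0 < spacing m L.
  by move=> m2 L0; rewrite divr_gt0 // subr_gt0 ltr1n.
have dx0 := sp _ _ hx Lx0; have dy0 := sp _ _ hy Ly0.
move: hb; set h := Num.min _ _ => hb.
have h0 : 0 < h by rewrite lt_min dx0.
have inv_le x : h <= x -> 1 / x ^+ 2 <= 1 / h ^+ 2.
  move=> hx'; have x0 := lt_le_trans h0 hx'.
  by rewrite !div1r lef_pV2 ?posrE ?exprn_gt0 // lerXn2r // nnegrE ltW.
have ix : 1 / spacing mx Lx ^+ 2 <= 1 / h ^+ 2 by rewrite inv_le // ge_min lexx.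
have iy : 1 / spacing my Ly ^+ 2 <= 1 / h ^+ 2
  by rewrite inv_le // ge_min lexx orbT.
apply: (implicit_splitting_converges _ _ _ _ _ _
  (2 * (1 / spacing mx Lx ^+ 2 + 1 / spacing my Ly ^+ 2))) => //.
- by rewrite mulr_ge0 // addr_ge0 // divr_ge0 // sqr_ge0.
- apply: (@le_lt_trans _ _ (8 * b / h ^+ 2)).
    have := lerD (ler_wpM2l b0 ix) (ler_wpM2l b0 iy); lra.
  by rewrite ltr_pdivrMr // exprn_gt0.
- exact: neumann_laplacian_diag.
- exact: neumann_laplacian_offdiag.
- by move=> p; apply: neumann_laplacian_row_sum.
- exact: N1D_N2_le.
Qed.

Theorem theorem7 (R : realType) (mx my : nat) (Lx Ly : R)
    (Theta : set (R * R)) (Dphi Dc w dt : R) (meth : imex_method)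
    (hmx : (2 <= mx)%N) (hmy : (2 <= my)%N) (hLx : 0 < Lx) (hLy : 0 < Ly)
    (hTheta : Theta `<=` interior (domain Lx Ly))
    (hnode : exists p : 'I_(my * mx), Theta (node Lx Ly p))
    (hDphi : 0 < Dphi) (hDc : 0 < Dc) (hw : 0 < w) (hdt : 0 < dt) :
  let dx := spacing mx Lx in
  let dy := spacing my Ly in
  let h := Num.min dx dy in
  let gam := gamma R meth in
  let M := neumann_laplacian mx my Lx Ly in
  let N := N1 mx my Lx Ly Theta + N2 mx my Lx Ly Theta in
  dt * Dphi / (gam + w * dt) * (1 / dx ^+ 2 + 1 / dy ^+ 2) < 1 ->
  dt * Dc / gam * (1 / dx ^+ 2 + 1 / dy ^+ 2) < 1 ->
  (10 * Dphi / w < h ^+ 2 \/ dt < gam * h ^+ 2 / (10 * Dphi - w * h ^+ 2)) ->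
  dt < gam * h ^+ 2 / (10 * Dc) ->
  (forall gphi : 'cV[R]_(my * mx),
     phi_iteration_converges meth dt Dphi w M N gphi) /\
  (forall gc : 'cV[R]_(my * mx),
     c_iteration_converges meth dt Dc M N gc).
Proof.
move=> dx dy h gam M N _ _ hphi hc.
have gam0 : 0 < gam by rewrite /gam; case: (meth) => //=; lra.
have gh0 : 0 <= gam * h ^+ 2 by rewrite mulr_ge0 ?sqr_ge0 // ltW.
have bc : 10 * (dt * Dc) < gam * h ^+ 2.
  move: hc; rewrite ltr_pdivlMr; last by rewrite mulr_gt0.
  by rewrite mulrCA.
(* When [10 * Dphi < w * h ^+ 2] the bound holds for every [dt].  Otherwise the
   first alternative fails and the second applies; if [10 * Dphi = w * h ^+ 2],
   its right-hand side is a quotient by zero, that is zero, contradicting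
   [0 < dt]. *)
have bphi : 10 * (dt * Dphi) < (gam + w * dt) * h ^+ 2.
  have [wh|wh] := ltP (10 * Dphi) (w * h ^+ 2).
    have := ltr_pM2l hdt (10 * Dphi) (w * h ^+ 2); rewrite wh; lra.
  have {hphi} : dt < gam * h ^+ 2 / (10 * Dphi - w * h ^+ 2).
    by case: hphi => //; rewrite ltr_pdivrMr // (mulrC (h ^+ 2)) ltNge wh.
  move: wh; rewrite -subr_ge0 le_eqVlt => /predU1P [<-|wh].
    by rewrite invr0 mulr0 ltNge (ltW hdt).
  by rewrite ltr_pdivlMr //; lra.
have pDc : 0 < dt * Dc by rewrite mulr_gt0.
have pDphi : 0 < dt * Dphi by rewrite mulr_gt0.
rewrite /phi_iteration_converges /c_iteration_converges /M /N.
move: bc bphi; rewrite /gam /h /dx /dy.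
by case: (meth) => /= bc bphi; split=> g;
  apply: neumann_iteration_converges => //; lra.
Qed.
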